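(* Let $(M,d)$ be an NPC space. For $(x_1,\ldots,x_n),(y_1,\ldots,y_n)\in M^n$, a weight $\mathbf{w}=(w_1,\ldots,w_n)$, and the corresponding finitely supported probability measures $q_1=\sum_{i=1}^n w_i\delta_{x_i}$ and $q_2=\sum_{i=1}^n w_i\delta_{y_i}$ on $M$, $$d\big(\mathfrak{G}_n(\mathbf{w};x_1,\ldots,x_n),\mathfrak{G}_n(\mathbf{w};y_1,\ldots,y_n)\big)\leq W(q_1,q_2)\leq \sum_{i=1}^n w_i\,d(x_i,y_i).$$ Hence, in particular, the least squares mean $\mathfrak{G}_n(\mathbf{w};\cdot):M^n\to M$ is continuous for each weight $\mathbf{w}$.
   Context: An NPC space is a complete metric space $(M,d)$ such that for all $x,y\in M$ there exists $m\in M$ such that for all $z\in M$, $d^2(m,z)\leq \frac12 d^2(x,z)+\frac12 d^2(y,z)-\frac14 d^2(x,y)$ (also called a global CAT(0) space or Hadamard space). A weight is a tuple $\mathbf{w}=(w_1,\ldots,w_n)$ of positive real numbers with $\sum_{i=1}^n w_i=1$. The weighted least squares mean of $(a_1,\ldots,a_n)\in M^n$ is $\mathfrak{G}_n(\mathbf{w};a_1,\ldots,a_n)=\arg\min_{z\in M}\sum_{i=1}^n w_i d^2(z,a_i)$; in an NPC space the minimizer exists and is unique (known fact). $\delta_x$ denotes the point mass at $x$. $\mathcal{P}(M)$ is the set of Borel probability measures on $M$ with separable support, and $\mathcal{P}^1(M)$ is the set of those $q\in\mathcal{P}(M)$ with $\int_M d(z,x)\,q(dx)<\infty$ for all $z\in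 M$. A coupling of $p,q\in\mathcal{P}(M)$ is a measure $\mu\in\mathcal{P}(M\times M)$ with $\mu(B\times M)=p(B)$ and $\mu(M\times B)=q(B)$ for all Borel sets $B\subseteq M$. The ($L^1$-)Wasserstein distance on $\mathcal{P}^1(M)$ is $W(p,q)=\inf\left\{\int_{M\times M}d(x,y)\,\mu(dx\,dy): \mu \text{ is a coupling of } p \text{ and } q\right\}$. *)

(* Defs.v *)
From HB Require Import structures.
From mathcomp Require Import all_boot all_order all_algebra.
From mathcomp Require Import all_classical all_reals all_analysis.
From mathcomp Require Import measurable_realfun.

Set Implicit Arguments.
Unset Strict Implicit.
Unset Printing Implicit Defensive.
Import Order.TTheory GRing.Theory Num.Theory.
Import numFieldNormedType.Exports.

Local Open Scope classical_set_scope.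
Local Open Scope ring_scope.

(* Completeness is the library's, i.e., convergence of the proper Cauchy filters;
   the library's [Complete] includes a distinguished point, so that the spaces
   below are nonempty. *)
#[short(type="completeMetricType")]
HB.structure Definition CompleteMetric (R : numDomainType) :=
  {M of Metric R M & Complete M}.

HB.mixin Record isNPC (R : realType) M & CompleteMetric R M := {
  npc_ineq : forall x y : M, exists m : M, forall z : M,
    mdist m z ^+ 2 <= 2^-1 * mdist x z ^+ 2 + 2^-1 * mdist y z ^+ 2
                      - 4^-1 * mdist x y ^+ 2
}.

#[short(type="npcType")]
HB.structure Definition NPC (R : realType) :=
  {M of isNPC R M & CompleteMetric R M}.

Record weight (R : realType) (n : nat) := Weight {
  wt :> 'I_n -> R ;
  wt_gt0 : forall i, 0 < wt i ;
  wt_sum1 : \sum_(i < n) wt i = 1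
}.

Section least_squares_mean.
Context (R : realType) (M : npcType R) (n : nat).

Definition lsq_cost (w : weight R n) (a : 'I_n -> M) (z : M) : R :=
  \sum_(i < n) w i * mdist z (a i) ^+ 2.

Definition argmin (f : M -> R) : set M := [set z | forall y, f z <= f y].

(* [get] picks an element of the set of minimizers, which is a singleton in an
   NPC space. *)
Definition lsmean (w : weight R n) (a : 'I_n -> M) : M :=
  get (argmin (lsq_cost w a)).

End least_squares_mean.

(* For [T := M * M] this is the Borel sigma-algebra of the product topology, which
   may be strictly finer than the product sigma-algebra if [M] is not separable. *)
Notation borel T := (g_sigma_algebraType (@open T)).

Definition separable_set (T : topologicalType) (A : set T) : Prop :=
  exists D : set T, [/\ countable D, D `<=` A & A `<=` closure D].

Definition msupport (T : topologicalType) (R : realType) (mu : set T -> \bar R) :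
  set T := [set x | forall U, open_nbhs x U -> (0 < mu U)%E].

Section finitely_supported.
Local Open Scope ereal_scope.
Context d (T : measurableType d) (R : realType) (n : nat).
Variables (w : weight R n) (x : 'I_n -> T).

Definition wdirac (A : set T) : \bar R := \sum_(i < n) (w i)%:E * \d_(x i) A.

Let wdirac0 : wdirac set0 = 0.
Proof. by rewrite /wdirac big1// => i _; rewrite measure0 mule0. Qed.

Let term_ge0 i A : 0 <= (w i)%:E * \d_(x i) A.
Proof. by rewrite mule_ge0// lee_fin ltW// wt_gt0. Qed.

Let wdirac_ge0 A : 0 <= wdirac A.
Proof. by apply: sume_ge0 => i _; exact: term_ge0. Qed.

Let wdirac_sigma_additive : semi_sigma_additive wdirac.
Proof.
move=> F mF tF mUF; rewrite [X in _ --> X](_ : _ =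
    lim ((fun n => \sum_(0 <= i < n) wdirac (F i)) @ \oo)).
  by apply: is_cvg_ereal_nneg_natsum => k _; exact: wdirac_ge0.
rewrite nneseries_sum; last by move=> *; exact: term_ge0.
apply: eq_bigr => /= i _.
rewrite nneseriesZl//.
by congr (_ * _); exact: measure_semi_bigcup.
Qed.

HB.instance Definition _ := isMeasure.Build _ _ _ wdirac
  wdirac0 wdirac_ge0 wdirac_sigma_additive.

Let wdirac_setT : wdirac setT = 1.
Proof.
rewrite /wdirac; under eq_bigr do rewrite diracT mule1.
by rewrite sumEFin wt_sum1.
Qed.

HB.instance Definition _ :=
  Measure_isProbability.Build _ _ _ wdirac wdirac_setT.

End finitely_supported.

Section wasserstein.
Local Open Scope ereal_scope.
Context (R : realType) (M : npcType R).

Record P1 := MkP1 {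
  P1_prob :> probability (borel M) R ;
  P1_separable : separable_set (msupport (P1_prob : set M -> \bar R)) ;
  P1_integrable : forall z : M, \int[P1_prob]_x (mdist z x)%:E < +oo
}.

Definition coupling (p q : P1) : set (probability (borel (M * M)%type) R) :=
  [set mu | [/\ separable_set (msupport (mu : set (M * M) -> \bar R)),
      forall B : set (borel M), measurable B -> mu (B `*` setT) = p B &
      forall B : set (borel M), measurable B -> mu (setT `*` B) = q B]].

Definition wasserstein (p q : P1) : \bar R :=
  ereal_inf [set \int[mu]_xy (mdist xy.1 xy.2)%:E | mu in coupling p q].

End wasserstein.

Section wdirac_P1.
Local Open Scope ereal_scope.
Context (R : realType) (M : npcType R) (n : nat).
Variables (w : weight R n) (x : 'I_n -> M).

Let q : probability (borel M) R := @wdirac _ (borel M) R n w x.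

Let qE (A : set M) : q A = \sum_(i < n) (w i)%:E * (x i \in A)%:R%:E.
Proof. by apply: eq_bigr => i _; rewrite diracE. Qed.

Let finite_range : finite_set (range x).
Proof. exact/finite_image/finite_finset. Qed.

Let closed_range : closed (range x).
Proof.
have [+ _] := @accessible_finite_set_closed M; apply=> //.
exact/hausdorff_accessible/metric_hausdorff.
Qed.

Let q0 : q (~` range x) = 0.
Proof.
rewrite qE big1// => i _; rewrite memNset ?mule0//= => nx.
by apply: nx; exists i.
Qed.

Lemma wdirac_separable : separable_set (msupport (q : set M -> \bar R)).
Proof.
exists (msupport (q : set M -> \bar R)); split=> //; last exact: subset_closure.
apply/finite_set_countable/(sub_finite_set _ finite_range) => y sy.
apply: contrapT => xy; have /(_ (~` range x)) := sy.
by rewrite q0 ltxx => /(_ (conj (closed_openC closed_range) xy)).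
Qed.

Let measurable_mdist (z : M) :
  measurable_fun [set: borel M] (EFin \o (mdist z : borel M -> R)).
Proof.
apply/measurable_EFinP => mD.
apply: (measurability _ (RGenCInfty.measurableE R)) => //.
move=> _ [_ [r ->] <-]; rewrite setTI.
rewrite (_ : _ @^-1` _ = ~` ball z r); last first.
  apply/seteqP; split=> y /=; rewrite ballEmdist/= in_itv/= andbT.
    by rewrite leNgt => /negP.
  by move=> /negP; rewrite -leNgt.
apply: measurableC; apply: sub_sigma_algebra.
rewrite openE => y zy; apply/nbhs_ballP.
move: zy; rewrite ballEmdist/= => zy.
exists (r - mdist z y)%R => /=; first by rewrite subr_gt0.
move=> t; rewrite !ballEmdist/= ltrBrDl => yt.
exact: le_lt_trans (metric_triangle _ _ _) yt.
Qed.

Lemma wdirac_integrable (z : M) : \int[q]_y (mdist z y)%:E < +oo.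
Proof.
pose C : R := (\sum_(i < n) mdist z (x i))%R.
have C0 : (0 <= C)%R by apply: sumr_ge0 => i _; exact: mdist_ge0.
apply: (@le_lt_trans _ _ (\int[q]_y C%:E)).
  apply: ae_ge0_le_integral => //.
  - by move=> y _; rewrite lee_fin mdist_ge0.
  - exact: measurable_mdist.
  - exists (~` range x); split.
    + by apply: sub_sigma_algebra; exact: closed_openC.
    + exact: q0.
    + move=> y /= nCy [i _ xy]; apply: nCy => _; rewrite -xy lee_fin /C.
      rewrite (bigD1 i)//= lerDl.
      by apply: sumr_ge0 => j _; exact: mdist_ge0.
by rewrite integral_cst//= probability_setT mule1 ltry.
Qed.

Definition wdiracP1 : P1 M := MkP1 wdirac_separable wdirac_integrable.

End wdirac_P1.

(* Main.v *)
Require Import Defs.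
From HB Require Import structures.
From mathcomp Require Import all_boot all_order all_algebra.
From mathcomp Require Import all_classical all_reals all_analysis.
From mathcomp Require Import measurable_realfun.
From mathcomp Require Import ring lra.
Import Order.TTheory GRing.Theory Num.Theory.
Import numFieldNormedType.Exports.
Local Open Scope classical_set_scope.
Local Open Scope ring_scope.

(** The barycenters [a] and [b] of [q1] and [q2] are compared with each other
    through a single pointwise inequality on pairs [(u, v)], integrated against
    an arbitrary coupling.  Two facts about NPC spaces carry the argument.

    - Variance inequality: if [a] is the least squares mean of a finitely
      supported [q], then [int d^2(z, .) dq >= int d^2(a, .) dq + d^2(z, a)] for
      all [z] ([variance_inequality]).
    - Quadruple inequality (Reshetnyak):
      [d^2(u, b) + d^2(v, a) <= d^2(u, a) + d^2(v, b) + 2 d(a, b) d(u, v)]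
      ([quadruple_inequality]).

    Integrating the second against a coupling [mu] of [q1] and [q2], each square
    depends on one variable only and integrates to a least squares cost; by the
    first fact used at [b] for [q1] and at [a] for [q2], the left side exceeds
    the sum of the two squares on the right by at least [2 d^2(a, b)].  Hence
    [2 d^2(a, b) <= 2 d(a, b) int d dmu], which is the lower bound on [W]
    ([mdist_lsmean_le_wasserstein]).

    Both facts come from strong midpoint convexity.  A weighted sum [f] of
    squared distances satisfies
    [f m <= (f u + f v) / 2 - d^2(u, v) / 4] at each midpoint [m].  Points where
    [f] is close to its infimum are therefore close to each other, so that
    completeness yields a minimizer; and comparing [f] at a point with [f] at
    its midpoint with the minimizer, over and over, yields the variance
    inequality.  Applied to two points [x], [y] with weights [1 - t], [t], it
    provides the point at parameter [t] of the geodesic from [x] to [y].  Taking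
    this point on one diagonal of a quadruple and bounding the other diagonal by
    the triangle inequality gives the quadruple inequality up to a parameter,
    which is then optimized.

    The upper bound on [W] is the cost of the coupling that puts mass [w i] at
    [(x i, y i)].  Together the two bounds make the least squares mean
    1-Lipschitz with respect to the weighted sum of the coordinate distances, hence
    continuous. *)

(** * Continuity of the distance *)

Lemma mdist_continuous {R : realType} (M : metricType R) :
  continuous (fun p : M * M => mdist p.1 p.2).
Proof.
move=> [x y]; apply/cvgrPdist_lt => e e0.
exists (ball x (e / 2), ball y (e / 2)).
  by split; apply: nbhsx_ballx; rewrite divr_gt0.
move=> [x' y']; rewrite !ballEmdist => -[/= xx' yy'].
have := metric_triangle x x' y; have := metric_triangle x' y' y.
have := metric_triangle x' x y'; have := metric_triangle x y y'.
rewrite (metric_sym x' x) (metric_sym y' y) => *.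
by rewrite ltr_norml; apply/andP; split; lra.
Qed.

Lemma mdistl_continuous {R : realType} (M : metricType R) (a : M) :
  continuous (fun z : M => mdist z a).
Proof.
move=> z; apply: (cvg_comp (fun z : M => (z, a)) _ _ (mdist_continuous M (z, a))).
by apply: cvg_pair; [exact: cvg_id|exact: cvg_cst].
Qed.

Lemma sqr_mdistl_continuous {R : realType} (M : metricType R) (a : M) :
  continuous (fun z : M => mdist z a ^+ 2).
Proof.
move=> z; rewrite /continuous_at expr2; under eq_fun do rewrite expr2.
by apply: cvgM; exact: mdistl_continuous.
Qed.

(** * Strong midpoint convexity and least squares means *)

Section midpoint_convexity.
Context {R : realType} {M : npcType R}.
Implicit Types (x y z u v m : M) (f : M -> R).

Definition npc_midpoint x y m := forall z,
  mdist m z ^+ 2 <= 2^-1 * mdist x z ^+ 2 + 2^-1 * mdist y z ^+ 2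
                    - 4^-1 * mdist x y ^+ 2.

(** The midpoint inequality at [z := x] bounds [d(m, x)] by [d(x, y) / 2]; the
    triangle inequality then leaves at least the other half for [d(m, y)]. *)
Lemma npc_midpoint_far x y m :
  npc_midpoint x y m -> mdist x y <= 2 * mdist m y.
Proof.
move=> /(_ x); rewrite mdistxx expr0n/= mulr0 add0r (metric_sym y) => mx.
have := metric_triangle x m y; rewrite (metric_sym x m) => tri.
have := mdist_ge0 x y => d0.
suff : mdist m x <= mdist x y / 2 by lra.
by rewrite -(ler_pXn2r (ltn0Sn 1)) ?nnegrE ?mdist_ge0// ?divr_ge0//; nra.
Qed.

(** The factor [1/4] is the one for which each squared distance [d^2(., z)] has
    this property, by the choice of the midpoint. *)
Definition strongly_midconvex f := forall u v m, npc_midpoint u v m ->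
  f m <= 2^-1 * f u + 2^-1 * f v - 4^-1 * mdist u v ^+ 2.

(** The sublevel sets [f < inf f + e] form a Cauchy filter: if [x] and [y] both
    lie in it, evaluating [f] at a midpoint gives [d^2(x, y) < 4 e].  The limit
    of this filter is a minimizer. *)
Lemma strongly_midconvex_argmin f : continuous f -> (forall z, 0 <= f z) ->
  strongly_midconvex f -> argmin f !=set0.
Proof.
move=> cf f0 sf; pose I := inf (range f).
have hI : has_inf (range f).
  by split; [exists (f point), point | exists 0 => _ [z _ <-]].
have If z : I <= f z by apply: ge_inf; [exact: hI.2|exists z].
have exI e : 0 < e -> exists z, f z < I + e.
  by move=> /inf_adherent/(_ hI)[_ [z _ <-] ?]; exists z.
pose F := filter_from [set e : R | 0 < e] (fun e => [set z | f z < I + e]).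
have FF : ProperFilter F.
  apply: filter_from_proper; last by move=> e /exI.
  apply: filter_from_filter; first by exists 1 => /=.
  move=> a b /= a0 b0; exists (Order.min a b); first by rewrite /= lt_min a0.
  by move=> z /=; rewrite -ltrBlDl lt_min !ltrBlDl => /andP[].
have /cauchy_cvg/cvg_ex[l Fl] : cauchy F.
  apply: cauchy_exP => e e0.
  have d0 : 0 < e ^+ 2 / 4 by rewrite divr_gt0// exprn_gt0.
  have [x fx] := exI _ d0; exists x, (e ^+ 2 / 4) => // y /= fy.
  rewrite ballEmdist/= -(ltr_pXn2r (ltn0Sn 1)) ?nnegrE ?mdist_ge0// ?ltW//.
  have [m xym] := npc_ineq x y.
  by have := sf _ _ _ xym; have := If m => *; lra.
exists l => y; apply: le_trans (If y); apply/ler_addgt0Pr => e e0.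
have fFl : f @ F --> f l by exact: cvg_comp Fl (cf l).
apply: (cvgr_to_le fFl).
by exists e => //= z /ltW.
Qed.

(** If the inequality holds with a factor [c] in front of the squared distance,
    then using it at the midpoint of [z] and [a], which is at distance at least
    [d(z, a) / 2] from [a], gives it with the factor [(1 + c) / 2].  Starting
    from [c = 0], the factors [1 - 2^-k] tend to [1]. *)
Lemma strongly_midconvex_variance f a z : strongly_midconvex f ->
  argmin f a -> f a + mdist z a ^+ 2 <= f z.
Proof.
move=> sf fa.
have bisect k : forall y, f a + (1 - 2^-1 ^+ k) * mdist y a ^+ 2 <= f y.
  elim: k => [y|k IH y]; first by rewrite expr0 subrr mul0r addr0 fa.
  have [m yam] := npc_ineq y a.
  have := IH m; have := sf _ _ _ yam.
  have := npc_midpoint_far _ _ _ yam.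
  have := mdist_ge0 y a; have := mdist_ge0 m a.
  rewrite [2^-1 ^+ k.+1]exprS.
  have : 2^-1 ^+ k <= 1 :> R by rewrite exprn_ile1//; lra.
  set c := 2^-1 ^+ k; set D := mdist y a; set E := mdist m a.
  move=> c1 E0 D0 DE sfm IHm.
  have DE2 : D ^+ 2 <= 4 * E ^+ 2 by nra.
  have := ler_wpM2l (_ : 0 <= 1 - c) DE2; rewrite subr_ge0 => /(_ c1).
  by lra.
have cv : (fun k => f a + (1 - 2^-1 ^+ k) * mdist z a ^+ 2) @ \oo -->
    f a + (1 - 0) * mdist z a ^+ 2.
  apply: cvgD; first exact: cvg_cst.
  apply: cvgMl; apply: cvgB; first exact: cvg_cst.
  by apply: cvg_expr; rewrite ger0_norm; lra.
rewrite subr0 mul1r in cv.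
by apply: (cvgr_to_le cv); apply: nearW => k; exact: bisect.
Qed.

Lemma strongly_midconvex_lsq n (w : weight R n) (a : 'I_n -> M) :
  strongly_midconvex (lsq_cost w a).
Proof.
move=> u v m uvm; rewrite /lsq_cost.
have -> : 4^-1 * mdist u v ^+ 2 = \sum_(i < n) w i * (4^-1 * mdist u v ^+ 2).
  by rewrite -mulr_suml wt_sum1 mul1r.
rewrite !mulr_sumr -big_split/= -sumrB; apply: ler_sum => i _.
by have := ler_wpM2l (ltW (wt_gt0 w i)) (uvm (a i)); lra.
Qed.

Lemma lsq_cost_continuous n (w : weight R n) (a : 'I_n -> M) :
  continuous (lsq_cost w a).
Proof.
move=> z; apply: cvg_big; first exact: add_continuous.
by move=> i _; apply: cvgMr; exact: sqr_mdistl_continuous.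
Qed.

Lemma lsmeanP n (w : weight R n) (a : 'I_n -> M) :
  argmin (lsq_cost w a) (lsmean w a).
Proof.
apply: getPex; apply: strongly_midconvex_argmin.
- exact: lsq_cost_continuous.
- move=> z; apply: sumr_ge0 => i _.
  by rewrite mulr_ge0// ?sqr_ge0// ltW// wt_gt0.
- exact: strongly_midconvex_lsq.
Qed.

Lemma variance_inequality n (w : weight R n) (a : 'I_n -> M) z :
  lsq_cost w a (lsmean w a) + mdist z (lsmean w a) ^+ 2 <= lsq_cost w a z.
Proof.
apply: strongly_midconvex_variance (lsmeanP _ _ _).
exact: strongly_midconvex_lsq.
Qed.

End midpoint_convexity.

(** * Geodesics and the quadruple inequality *)

(** The difference of the two sides, for [d = A + B], is
    [((1 - t) A - t B)^2]. *)
Lemma weighted_square_le {R : realFieldType} (t d A B : R) :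
  0 < t < 1 -> 0 <= d <= A + B ->
  t * (1 - t) * d ^+ 2 <= (1 - t) * A ^+ 2 + t * B ^+ 2.
Proof.
move=> /andP[t0 t1] /andP[d0 dAB].
apply: (@le_trans _ _ (t * (1 - t) * (A + B) ^+ 2)).
  by apply: ler_wpM2l; [apply: mulr_ge0; lra|nra].
by have := sqr_ge0 ((1 - t) * A - t * B); lra.
Qed.

Section quadruple_inequality.
Context {R : realType} {M : npcType R}.
Implicit Types (x y z m : M).

(** The point is the least squares mean of [x] and [y] with weights [1 - t] and
    [t]; repeated midpoints would only reach dyadic parameters [t]. *)
Lemma geodesic_point x y (t : R) : 0 < t < 1 -> exists m, forall z,
  mdist m z ^+ 2 <= (1 - t) * mdist x z ^+ 2 + t * mdist y z ^+ 2
                    - t * (1 - t) * mdist x y ^+ 2.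
Proof.
move=> t01.
pose s := fun i : 'I_2 => if i == ord0 then 1 - t else t.
have s0 i : 0 < s i by rewrite /s; case: ifP; lra.
have s1 : \sum_(i < 2) s i = 1 by rewrite big_ord_recl big_ord1 /s/=; lra.
pose a := fun i : 'I_2 => if i == ord0 then x else y.
exists (lsmean (Weight s0 s1) a) => z.
have := variance_inequality _ (Weight s0 s1) a z.
rewrite /lsq_cost !big_ord_recl !big_ord0/= /s/= /a/= !addr0.
set m := lsmean _ _.
rewrite (metric_sym m z) (metric_sym z x) (metric_sym z y).
have : 0 <= mdist x y <= mdist m x + mdist m y.
  by rewrite mdist_ge0 (metric_sym m x) metric_triangle.
by move=> /(weighted_square_le _ _ _ _ t01); lra.
Qed.

(** Let [m] be the point at parameter [t] on the diagonal from [x1] to [x3].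
    The triangle inequality at [m] bounds [t (1 - t) d^2(x2, x4)] by
    [t d^2(m, x2) + (1 - t) d^2(m, x4)], and the inequality that defines [m]
    brings in [d^2(x1, x3)] with a negative sign. *)
Lemma quadruple_param x1 x2 x3 x4 (t : R) : 0 < t < 1 ->
  t * (1 - t) * (mdist x1 x3 ^+ 2 + mdist x2 x4 ^+ 2
                 - mdist x1 x2 ^+ 2 - mdist x3 x4 ^+ 2)
  <= t ^+ 2 * mdist x2 x3 ^+ 2 + (1 - t) ^+ 2 * mdist x1 x4 ^+ 2.
Proof.
move=> t01; have [m mz] := geodesic_point x1 x3 t t01.
have t'01 : 0 < 1 - t < 1 by lra.
have : 0 <= mdist x2 x4 <= mdist m x2 + mdist m x4.
  by rewrite mdist_ge0 (metric_sym m x2) metric_triangle.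
move=> /(weighted_square_le _ _ _ _ t'01).
move: t01 t'01 => /andP[t0 _] /andP[t'0 _].
have := ler_wpM2l (ltW t0) (mz x2); have := ler_wpM2l (ltW t'0) (mz x4).
by rewrite (metric_sym x3 x2); lra.
Qed.

(** Divided by [t (1 - t)], the right side of [quadruple_param] reads
    [r p^2 + q^2 / r] with [r = t / (1 - t)]; its minimum [2 p q] is reached at
    [r = q / p], i.e., [t = q / (p + q)].  If [p] or [q] vanishes two vertices
    coincide and both sides agree. *)
Lemma quadruple_inequality x1 x2 x3 x4 :
  mdist x1 x3 ^+ 2 + mdist x2 x4 ^+ 2 <=
  mdist x1 x2 ^+ 2 + mdist x3 x4 ^+ 2 + 2 * mdist x2 x3 * mdist x1 x4.
Proof.
have := @quadruple_param x1 x2 x3 x4.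
have := mdist_ge0 x2 x3; have := mdist_ge0 x1 x4.
set p := mdist x2 x3; set q := mdist x1 x4 => q0 p0.
set S := mdist x1 x3 ^+ 2 + _ - _ - _ => H.
suff : S <= 2 * p * q by rewrite /S; lra.
have [p_eq0|p_neq0] := eqVneq p 0.
  rewrite p_eq0 mulr0 mul0r /S (mdist_positivity _ _ p_eq0) (metric_sym x3 x4).
  by lra.
have [q_eq0|q_neq0] := eqVneq q 0.
  rewrite q_eq0 mulr0 /S (mdist_positivity _ _ q_eq0) (metric_sym x4 x2).
  by rewrite (metric_sym x4 x3); lra.
have {}p0 : 0 < p by rewrite lt_neqAle eq_sym p_neq0.
have {}q0 : 0 < q by rewrite lt_neqAle eq_sym q_neq0.
have pq0 : 0 < p + q by rewrite addr_gt0.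
have t01 : 0 < q / (p + q) < 1.
  by rewrite divr_gt0//= ltr_pdivrMr// mul1r ltrDr.
have := H _ t01; rewrite -(ler_pM2r (exprn_gt0 2 pq0)).
have -> : q / (p + q) * (1 - q / (p + q)) * S * (p + q) ^+ 2 = p * q * S.
  by field; rewrite gt_eqF.
have -> : ((q / (p + q)) ^+ 2 * p ^+ 2 + (1 - q / (p + q)) ^+ 2 * q ^+ 2) *
    (p + q) ^+ 2 = p * q * (2 * p * q).
  by field; rewrite gt_eqF.
by rewrite ler_pM2l// mulr_gt0.
Qed.

End quadruple_inequality.

(** * Borel measurability and finitely supported measures *)

(** Joins the canonical topology and the canonical point of a product, so that
    the lemmas on Borel sigma-algebras below apply to [M * M]. *)
HB.instance Definition _ (T U : ptopologicalType) := Pointed.on (T * U)%type.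

Lemma borel_measurable_continuous {T U : ptopologicalType} (f : T -> U) :
  continuous f -> measurable_fun [set: borel T] (f : borel T -> borel U).
Proof.
move=> /continuousP cf.
apply: (@measurability _ _ (borel T) (borel U) setT f (@open U)) => //.
move=> _ [A oA <-].
by rewrite setTI; apply: sub_sigma_algebra; exact: cf.
Qed.

Lemma borel_measurable_continuous_EFin {R : realType} {T : ptopologicalType}
    (f : T -> R) :
  continuous f -> measurable_fun [set: borel T] (EFin \o (f : borel T -> R)).
Proof.
move=> /continuousP cf; apply/measurable_EFinP.
move=> mD; apply: (measurability _ (RGenOpens.measurableE R)) => //.
move=> _ [_ [a [b ->]] <-]; rewrite setTI.
by apply: sub_sigma_algebra; apply: cf; exact: interval_open.
Qed.

Lemma ge0_integral_wdirac d (T : measurableType d) {R : realType} n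
    (w : weight R n) (x : 'I_n -> T) (f : T -> \bar R) :
  measurable_fun setT f -> (forall t, 0 <= f t)%E ->
  (\int[wdirac w x]_t f t = \sum_(i < n) (w i)%:E * f (x i))%E.
Proof.
move=> mf f0.
pose k i := NngNum (ltW (wt_gt0 w i)).
(* [msum] sums a sequence of measures indexed by [nat], hence the extension by
   the zero measure. *)
pose m_ (j : nat) : {measure set T -> \bar R} :=
  if insub j is Some i then mscale (k i) (dirac (x i)) else mzero.
rewrite (eq_measure_integral (msum m_ n)).
  rewrite ge0_integral_measure_sum//; apply: eq_bigr => i _.
  rewrite /m_ valK ge0_integral_mscale// integral_dirac//.
  by rewrite diracT mul1e.
move=> A mA _; rewrite /wdirac /msum; apply: eq_bigr => i _.
by rewrite /m_ valK.
Qed.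

Lemma ge0_integral_image {R : realType} {T U : ptopologicalType}
    (mu : {measure set (borel T) -> \bar R})
    (nu : {measure set (borel U) -> \bar R}) (f : T -> U) (g : U -> R) :
  continuous f -> continuous g -> (forall z, 0 <= g z) ->
  (forall B : set (borel U), measurable B -> mu (f @^-1` B) = nu B) ->
  (\int[mu]_u (g (f u))%:E = \int[nu]_z (g z)%:E)%E.
Proof.
move=> cf cg g0 munu.
have mf := borel_measurable_continuous f cf.
have mg := borel_measurable_continuous_EFin g cg.
have := ge0_integral_pushforward mf mu measurableT mg.
rewrite preimage_setT => <-; last by move=> z _; rewrite lee_fin.
by apply: eq_measure_integral => B mB _; apply: etrans (munu B mB).
Qed.

(** In an accessible space finite sets are closed, so that the complement of the
    range of [x] is an open set of mass zero and the support is finite. *)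
Lemma wdirac_separable_support {R : realType} {T : ptopologicalType} n
    (w : weight R n) (x : 'I_n -> T) : accessible_space T ->
  separable_set (msupport (@wdirac _ (borel T) R n w x : set T -> \bar R)).
Proof.
move=> /accessible_finite_set_closed accT; set S := msupport _.
exists S; split=> //; last exact: subset_closure.
have finx : finite_set (range x) by exact/finite_image/finite_finset.
apply/finite_set_countable/(sub_finite_set _ finx) => y Sy.
apply: contrapT => xy.
have := Sy (~` range x) (conj (closed_openC (accT _ finx)) xy).
rewrite /wdirac/= big1 ?ltxx// => i _; rewrite diracE memNset ?mule0//= => nx.
by apply: nx; exists i.
Qed.

Lemma accessible_space_prod {T U : topologicalType} :
  accessible_space T -> accessible_space U -> accessible_space (T * U)%type.
Proof.
move=> aT aU [x1 x2] [y1 y2]; rewrite xpair_eqE negb_and => /orP[/aT|/aU].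
  move=> [A [oA xA yA]]; exists (fst @^-1` A); split; last 2 first.
  - by rewrite inE in xA *.
  - by rewrite inE in yA *.
  by apply: open_comp => // z _; exact: cvg_fst.
move=> [A [oA xA yA]]; exists (snd @^-1` A); split; last 2 first.
- by rewrite inE in xA *.
- by rewrite inE in yA *.
by apply: open_comp => // z _; exact: cvg_snd.
Qed.

(** * Bounds on the Wasserstein distance *)

Section wasserstein_bounds.
Context {R : realType} {M : npcType R}.

Lemma wasserstein_le_pairing n (w : weight R n) (x y : 'I_n -> M) :
  (wasserstein (wdiracP1 w x) (wdiracP1 w y) <=
   (\sum_(i < n) w i * mdist (x i) (y i))%:E)%E.
Proof.
pose xy i : M * M := (x i, y i).
apply: ereal_inf_lbound => /=.
exists (@wdirac _ (borel (M * M)%type) R n w xy).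
  split.
  - apply: wdirac_separable_support; apply: accessible_space_prod;
      exact/hausdorff_accessible/metric_hausdorff.
  - move=> B mB; apply: eq_bigr => i _; rewrite !diracE.
    by congr (_ * (_ : bool)%:R%:E)%E; apply/idP/idP; rewrite !inE /setX/=; tauto.
  - move=> B mB; apply: eq_bigr => i _; rewrite !diracE.
    by congr (_ * (_ : bool)%:R%:E)%E; apply/idP/idP; rewrite !inE /setX/=; tauto.
rewrite ge0_integral_wdirac; last 2 first.
- apply: (@borel_measurable_continuous_EFin R (M * M)%type
    (fun p => mdist p.1 p.2)); exact: mdist_continuous.
- by move=> p; rewrite lee_fin mdist_ge0.
by rewrite -sumEFin; apply: eq_bigr => i _; rewrite EFinM.
Qed.

Lemma coupling_integral_fst (p q : P1 M) mu (g : M -> R) : coupling p q mu ->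
  continuous g -> (forall z, 0 <= g z) ->
  (\int[mu]_u (g u.1)%:E = \int[p]_z (g z)%:E)%E.
Proof.
move=> [_ mup _] cg g0.
apply: (@ge0_integral_image R (M * M)%type M mu p fst g) => //.
  by move=> u; exact: cvg_fst.
by move=> B mB; apply: etrans (mup B mB); rewrite setXT.
Qed.

Lemma coupling_integral_snd (p q : P1 M) mu (g : M -> R) : coupling p q mu ->
  continuous g -> (forall z, 0 <= g z) ->
  (\int[mu]_u (g u.2)%:E = \int[q]_z (g z)%:E)%E.
Proof.
move=> [_ _ muq] cg g0.
apply: (@ge0_integral_image R (M * M)%type M mu q snd g) => //.
  by move=> u; exact: cvg_snd.
by move=> B mB; apply: etrans (muq B mB); rewrite setTX.
Qed.

Lemma integral_lsq_cost n (w : weight R n) (x : 'I_n -> M) (a : M) :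
  (\int[wdiracP1 w x]_z (mdist z a ^+ 2)%:E = (lsq_cost w x a)%:E)%E.
Proof.
rewrite ge0_integral_wdirac; last 2 first.
- apply: (@borel_measurable_continuous_EFin R M (fun z => mdist z a ^+ 2)).
  exact: sqr_mdistl_continuous.
- by move=> z; rewrite lee_fin sqr_ge0.
rewrite /lsq_cost -sumEFin; apply: eq_bigr => i _.
by rewrite EFinM metric_sym.
Qed.

(** The quadruple inequality at [u], [a], [b], [v] is integrated over
    [(u, v)].  It is arranged with nonnegative terms only, so that the integrals
    can be split before the cost of the coupling is known to be finite; the
    least squares costs are real numbers and cancel at the end. *)
Lemma mdist_lsmean_le_wasserstein n (w : weight R n) (x y : 'I_n -> M) :
  ((mdist (lsmean w x) (lsmean w y))%:E <=
   wasserstein (wdiracP1 w x) (wdiracP1 w y))%E.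
Proof.
apply/ereal_infP => _ [mu mup <-].
set a := lsmean w x; set b := lsmean w y; set D := mdist a b.
have [D_eq0|D_neq0] := eqVneq D 0.
  by rewrite D_eq0; apply: integral_ge0 => u _; rewrite lee_fin mdist_ge0.
have D0 : 0 < D by rewrite lt_neqAle eq_sym D_neq0 mdist_ge0.
pose I := (\int[mu]_u (mdist u.1 u.2)%:E)%E.
have msq1 c : measurable_fun [set: borel (M * M)%type]
    (fun u : borel (M * M)%type => (mdist u.1 c ^+ 2)%:E).
  apply: (@borel_measurable_continuous_EFin _ (M * M)%type
    (fun u => mdist u.1 c ^+ 2)) => u.
  apply: (cvg_comp (@fst M M) (fun z => mdist z c ^+ 2)); first exact: cvg_fst.
  exact: sqr_mdistl_continuous.
have msq2 c : measurable_fun [set: borel (M * M)%type]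
    (fun u : borel (M * M)%type => (mdist u.2 c ^+ 2)%:E).
  apply: (@borel_measurable_continuous_EFin _ (M * M)%type
    (fun u => mdist u.2 c ^+ 2)) => u.
  apply: (cvg_comp (@snd M M) (fun z => mdist z c ^+ 2)); first exact: cvg_snd.
  exact: sqr_mdistl_continuous.
have md : measurable_fun [set: borel (M * M)%type]
    (fun u : borel (M * M)%type => (mdist u.1 u.2)%:E).
  apply: (@borel_measurable_continuous_EFin R (M * M)%type
    (fun p => mdist p.1 p.2)); exact: mdist_continuous.
have sq0 (z c : M) : (0 <= (mdist z c ^+ 2)%:E)%E by rewrite lee_fin sqr_ge0.
have d0 (z c : M) : (0 <= (mdist z c)%:E)%E by rewrite lee_fin mdist_ge0.
have D2 : 0 <= 2 * D by rewrite mulr_ge0// ltW.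
have : (\int[mu]_u ((mdist u.1 b ^+ 2)%:E + (mdist u.2 a ^+ 2)%:E) <=
   \int[mu]_u ((mdist u.1 a ^+ 2)%:E + (mdist u.2 b ^+ 2)%:E
               + (2 * D)%:E * (mdist u.1 u.2)%:E))%E.
  apply: ge0_le_integral => //.
  - by move=> u _; rewrite adde_ge0.
  - exact: emeasurable_funD.
  - apply: emeasurable_funD; first exact: emeasurable_funD.
    exact: measurable_funeM.
  - move=> [u v] _ /=; rewrite -EFinM -!EFinD lee_fin.
    have := quadruple_inequality u a b v.
    by rewrite (metric_sym a v) (metric_sym b v) -/D; lra.
rewrite ge0_integralD// ge0_integralD//; last 4 first.
- by move=> u _; rewrite adde_ge0.
- exact: emeasurable_funD.
- by move=> u _; rewrite mule_ge0.
- exact: measurable_funeM.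
rewrite ge0_integralD// ge0_integralZl_EFin// -/I.
rewrite !(coupling_integral_fst _ _ _ _ mup (sqr_mdistl_continuous M _))//;
  do ?by move=> z; rewrite sqr_ge0.
rewrite !(coupling_integral_snd _ _ _ _ mup (sqr_mdistl_continuous M _))//;
  do ?by move=> z; rewrite sqr_ge0.
rewrite !integral_lsq_cost -/I.
have vx := variance_inequality _ w x b; have vy := variance_inequality _ w y a.
have : (0 <= I)%E by apply: integral_ge0.
case: I => [r _| _ _|//]; last by rewrite leey.
rewrite -EFinM -!EFinD !lee_fin => costs.
rewrite -(ler_pM2l D0).
rewrite -/a -/b -/D (metric_sym b a) -/D in vx vy.
by lra.
Qed.

Lemma lsmean_lipschitz n (w : weight R n) (x y : 'I_n -> M) :
  mdist (lsmean w x) (lsmean w y) <= \sum_(i < n) w i * mdist (x i) (y i).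
Proof.
rewrite -lee_fin.
apply: le_trans (mdist_lsmean_le_wasserstein _ _ _ _) _.
exact: wasserstein_le_pairing.
Qed.

Lemma lsmean_continuous n (w : weight R n) :
  continuous (lsmean w : {ptws 'I_n -> M} -> M).
Proof.
move=> x; have Fx := nbhs_filter (x : {ptws 'I_n -> M}).
apply/(@metricType_numDomainType.cvgrPdist_le R M {ptws 'I_n -> M} _ Fx).
move=> e e0.
have near_x : \forall y \near (x : {ptws 'I_n -> M}),
    forall i, mdist (x i) (y i) <= e.
  apply: (@filter_forall _ _
    (fun i (y : {ptws 'I_n -> M}) => mdist (x i) (y i) <= e) _ Fx) => i.
  apply: (@metricType_numDomainType.cvgr_dist_le R M _ _ Fx
    (fun y : {ptws 'I_n -> M} => y i) (x i)) => //.
  exact: (@proj_continuous 'I_n (fun=> M) i x).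
apply: filterS near_x => y xy; apply: le_trans (lsmean_lipschitz _ _ _ _) _.
rewrite -[e]mul1r -(wt_sum1 w) mulr_suml; apply: ler_sum => i _.
by rewrite ler_wpM2l// ltW// wt_gt0.
Qed.

End wasserstein_bounds.

Theorem proposition7p3 (R : realType) (M : npcType R) (n : nat)
    (w : weight R n) :
  (forall x y : 'I_n -> M,
     let q1 := wdiracP1 w x in
     let q2 := wdiracP1 w y in
     ((mdist (lsmean w x) (lsmean w y))%:E <= wasserstein q1 q2)%E /\
     (wasserstein q1 q2 <= (\sum_(i < n) w i * mdist (x i) (y i))%:E)%E) /\
  continuous (lsmean w : {ptws 'I_n -> M} -> M).
Proof.
split=> [x y /=|]; last exact: lsmean_continuous.
by split; [exact: mdist_lsmean_le_wasserstein|exact: wasserstein_le_pairing].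
Qed.
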